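(* Let $p$ be a prime and let $n,b$ be integers with $n\ge p$ and $n>b\ge 1$. Consider the action of the symmetric group $S_n$ on the graph $\Delta=\Delta^n_{1,b}$. Then $\Delta$ is a synthetic building for $S_n$ at $p$ if and only if $n=p+b$ and either $b=p+1$ or $1\le b\le p-1$. In all such cases, $\Delta$ is slender.
   Context: For integers $n>b\ge a\ge 1$, $\Delta^n_{a,b}$ is the incidence graph whose vertex set is the disjoint union of the set of $a$-element subsets of $[n]=\{1,\dots,n\}$ and the set of $b$-element subsets of $[n]$ (when $a=b$ these are two disjoint copies), with an edge joining an $a$-subset to a $b$-subset if and only if the $a$-subset is contained in the $b$-subset. $S_n$ acts in the natural way. A $G$-simplicial complex is a finite (possibly empty) simplicial complex $\Delta$ with a simplicial action of the finite group $G$ such that the setwise stabilizer of each simplex fixes that simplex pointwise. For $H\le G$, $\Delta^H$ denotes the fixed point subcomplex. Contractible spaces are non-empty. A $G$-simplicial complex $\Delta$ is a synthetic building for $G$ at the prime $p$ if (1) $\Delta^P$ is $N_G(P)$-equivariantly contractible for every non-identity $p$-subgroup $P\le G$, and (2) the stabilizer of every simplex has order divisible by $p$. $\Delta$ is slender if the orbit space $G\backslash\Delta$ is contractible. *)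

(* Defs.v *)
From HB Require Import structures.
From mathcomp Require Import all_boot all_order all_algebra all_fingroup.
From mathcomp Require Import all_solvable.
From mathcomp Require Import generic_quotient.
From mathcomp Require Import all_classical all_reals all_analysis.

Set Implicit Arguments.
Unset Strict Implicit.
Unset Printing Implicit Defensive.

Import Order.TTheory GRing.Theory Num.Theory.
Import GroupScope.
Import numFieldNormedType.Exports.

Local Open Scope classical_set_scope.
Local Open Scope ring_scope.

(* Homotopies are functions on the ambient X * R of which only the restriction
   to A * [0, 1] matters; `{within _, continuous _}` is continuity for the
   subspace topology. *)
Section Contractibility.
Context {R : realType} {X : topologicalType}.

Definition contracting_homotopy (A : set X) (x0 : X) (h : X * R -> X) : Prop :=
  [/\ A x0,
      {within A `*` `[0, 1], continuous h},
      forall x (t : R), A x -> 0 <= t <= 1 -> A (h (x, t)),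
      forall x, A x -> h (x, 0) = x
    & forall x, A x -> h (x, 1) = x0].

Definition contractible (A : set X) : Prop :=
  exists x0 h, contracting_homotopy A x0 h.

(* The identity of A is N-homotopic to a constant map with N-fixed value,
   i.e. A is N-homotopy equivalent to a point. *)
Definition equivariantly_contractible (gT : finGroupType) (N : {set gT})
    (act : X -> gT -> X) (A : set X) : Prop :=
  exists x0 h,
    [/\ contracting_homotopy A x0 h,
        forall g, g \in N -> act x0 g = x0
      & forall g x (t : R), g \in N -> A x -> 0 <= t <= 1 ->
          h (act x g, t) = act (h (x, t)) g].

End Contractibility.

Arguments contractible R {X} A.
Arguments equivariantly_contractible R {X gT} N act A.

(* Simplices are non-empty sets of vertices, so the complex without simplices
   (on an empty vertex type) is the empty complex. Actions are right actions, as
   everywhere in MathComp. The last field says that the setwise stabilizer of a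
   simplex fixes it pointwise. *)
Record gcomplex (gT : finGroupType) := GComplex {
  vertex : finType;
  simplices : {set {set vertex}};
  vact : {action gT &-> vertex};
  simplex_neq0 : finset.set0 \notin simplices;
  simplex_vertex : forall v : vertex, finset.set1 v \in simplices;
  simplex_face : forall s t : {set vertex}, s \in simplices ->
    t \subset s -> t != finset.set0 -> t \in simplices;
  simplex_act : forall (s : {set vertex}) (g : gT), s \in simplices ->
    [set vact v g | v in s]%SET \in simplices;
  simplex_stab : forall s : {set vertex}, s \in simplices ->
    ('N(s | vact) \subset 'C(s | vact))%g
}.

Section Realization.
Context (R : realType) (gT : finGroupType) (D : gcomplex gT).

Definition weights : topologicalType :=
  prod_topology (fun _ : vertex D => R).

(* The geometric realization in barycentric coordinates, with the topology
   induced by the finite product R^(vertex D). *)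
Definition realization (K : {set {set vertex D}}) : set weights :=
  [set x | [/\ forall v, 0 <= x v, \sum_v x v = 1
             & [set v | x v != 0]%SET \in K]].

(* The linear extension of the action on vertices, again a right action:
   the image of x has at v.g the coordinate that x has at v. *)
Definition weights_act (x : weights) (g : gT) : weights :=
  fun v => x (vact D v g^-1%g).

(* Because of simplex_stab, the realization of this subcomplex is the fixed
   point set of H in the realization of D. *)
Definition fixed_simplices (H : {set gT}) : {set {set vertex D}} :=
  [set s in simplices D | s \subset 'Fix_(vact D)(H)%g]%SET.

Definition in_same_orbit (x y : realization (simplices D)) : bool :=
  `[< exists g : gT, val y = weights_act (val x) g >].

Lemma weights_actM x g h :
  weights_act x (g * h)%g = weights_act (weights_act x g) h.
Proof. by apply/funext => v; rewrite /weights_act invMg actM. Qed.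

Lemma weights_act1 x : weights_act x 1%g = x.
Proof. by apply/funext => v; rewrite /weights_act invg1 act1. Qed.

Lemma in_same_orbit_refl : reflexive in_same_orbit.
Proof. by move=> x; apply/asboolP; exists 1%g; rewrite weights_act1. Qed.

Lemma in_same_orbit_sym : symmetric in_same_orbit.
Proof.
by move=> x y; apply/asboolP/asboolP => -[g e]; exists g^-1%g;
  rewrite e -weights_actM mulgV weights_act1.
Qed.

Lemma in_same_orbit_trans : transitive in_same_orbit.
Proof.
move=> y x z /asboolP[g e] /asboolP[h f]; apply/asboolP; exists (g * h)%g.
by rewrite weights_actM -e.
Qed.

Canonical in_same_orbit_equiv :=
  EquivRel in_same_orbit in_same_orbit_refl in_same_orbit_sym
    in_same_orbit_trans.

Definition orbit_space : topologicalType :=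
  quotient_topology {eq_quot in_same_orbit}%qT.

Definition slender : Prop := contractible R [set: orbit_space].

Definition synthetic_building (p : nat) : Prop :=
  (forall P : {group gT}, p.-group P -> P :!=: 1%g ->
     equivariantly_contractible R 'N(P)%g weights_act
       (realization (fixed_simplices P))) /\
  (forall s, s \in simplices D -> p %| #|'N(s | vact D)%g|)%N.

End Realization.

Section IncidenceGraph.
Context (n a b : nat).

Definition ksubset (k : nat) : finType := {A : {set 'I_n} | #|A| == k}.

(* A disjoint union: for a = b there are two copies of each a-subset. *)
Definition inc_vertex : finType := (ksubset a + ksubset b)%type.

Definition inc_edges : {set {set inc_vertex}} :=
  [set e | [exists A : ksubset a, exists B : ksubset b,
     (val A \subset val B) && (e == [set inl A; inr B])]]%SET.

Definition inc_simplices : {set {set inc_vertex}} :=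
  ([set [set v] | v : inc_vertex] :|: inc_edges)%SET.

Lemma ksubset_act_subproof k (A : ksubset k) (g : {perm 'I_n}) :
  #|g @: val A| == k.
Proof. by rewrite card_imset ?(valP A)//; apply: perm_inj. Qed.

Definition ksubset_act k (A : ksubset k) (g : {perm 'I_n}) : ksubset k :=
  Sub (g @: val A) (ksubset_act_subproof A g).

Definition inc_act_fun (v : inc_vertex) (g : {perm 'I_n}) : inc_vertex :=
  match v with
  | inl A => inl (ksubset_act A g)
  | inr B => inr (ksubset_act B g)
  end.

Lemma ksubset_act1 k (A : ksubset k) : ksubset_act A 1%g = A.
Proof.
apply/val_inj; rewrite /= -[RHS]imset_id; apply: eq_imset => i.
by rewrite perm1.
Qed.

Lemma ksubset_actM k (A : ksubset k) g h :
  ksubset_act A (g * h)%g = ksubset_act (ksubset_act A g) h.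
Proof.
apply/val_inj; rewrite /= -imset_comp; apply: eq_imset => i.
by rewrite permM.
Qed.

Lemma inc_act_fun1 : inc_act_fun^~ 1%g =1 id.
Proof. by case=> A; rewrite /= ksubset_act1. Qed.

Lemma inc_act_funM v : act_morph inc_act_fun v.
Proof. by case: v => A g h; rewrite /= ksubset_actM. Qed.

Definition inc_act : {action {perm 'I_n} &-> inc_vertex} :=
  TotalAction inc_act_fun1 inc_act_funM.

Lemma inc_simplicesP (s : {set inc_vertex}) :
  reflect ((exists v, s = finset.set1 v) \/
           exists (A : ksubset a) (B : ksubset b),
             val A \subset val B /\ s = [set inl A; inr B]%SET)
          (s \in inc_simplices).
Proof.
rewrite !inE; apply: (iffP orP) => -[].
- by case/imsetP => v _ ->; left; exists v.
- by case/existsP => A /existsP[B /andP[AB /eqP->]]; right; exists A, B.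
- by case=> v ->; left; apply/imsetP; exists v.
- case=> A [B [AB ->]]; right; apply/existsP; exists A; apply/existsP.
  by exists B; rewrite AB eqxx.
Qed.

Lemma inc_simplex_neq0 : finset.set0 \notin inc_simplices.
Proof.
apply/inc_simplicesP => -[[v]|[A [B [_]]]] /setP.
  by move/(_ v); rewrite !inE eqxx.
by move/(_ (inl A)); rewrite !inE eqxx.
Qed.

Lemma inc_simplex_vertex (v : inc_vertex) : finset.set1 v \in inc_simplices.
Proof. by apply/inc_simplicesP; left; exists v. Qed.

Lemma inc_simplex_face (s t : {set inc_vertex}) : s \in inc_simplices ->
  t \subset s -> t != finset.set0 -> t \in inc_simplices.
Proof.
case/inc_simplicesP => [[v ->]|[A [B [AB ->]]]] ts t0.
  by move: ts; rewrite subset1 (negPf t0) orbF => /eqP->;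
    apply: inc_simplex_vertex.
have tE : t = [set w in [:: inl A; inr B] | w \in t]%SET.
  apply/setP => w; rewrite !inE; case wt: (w \in t); rewrite ?andbF ?andbT//.
  by have := fintype.subsetP ts _ wt; rewrite !inE => ->.
apply/inc_simplicesP.
case At: (inl A \in t); case Bt: (inr B \in t).
- right; exists A, B; split => //; rewrite tE; apply/setP => w; rewrite !inE.
  by case: eqP => [->|_]; [rewrite At|case: eqP => [->|_]; rewrite ?Bt].
- left; exists (inl A); rewrite tE; apply/setP => w; rewrite !inE.
  by case: eqP => [->|_]; [rewrite At|case: eqP => [->|_]; rewrite ?Bt].
- left; exists (inr B); rewrite tE; apply/setP => w; rewrite !inE.
  by case: eqP => [->|_]; [rewrite At|case: eqP => [->|_]; rewrite ?Bt].
- case/finset.set0Pn: t0 => w wt; have := fintype.subsetP ts _ wt.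
  by rewrite !inE => /orP[]/eqP wE; rewrite -wE wt in At Bt.
Qed.

Lemma inc_simplex_act (s : {set inc_vertex}) (g : {perm 'I_n}) :
  s \in inc_simplices -> [set inc_act v g | v in s]%SET \in inc_simplices.
Proof.
case/inc_simplicesP => [[v ->]|[A [B [AB ->]]]]; apply/inc_simplicesP.
  by left; exists (inc_act v g); rewrite imset_set1.
right; exists (ksubset_act A g), (ksubset_act B g); split.
  exact: imsetS.
by rewrite imsetU1 imset_set1.
Qed.

Lemma inc_simplex_stab (s : {set inc_vertex}) : s \in inc_simplices ->
  ('N(s | inc_act) \subset 'C(s | inc_act))%g.
Proof.
move=> sD; apply/fintype.subsetP => g gN; apply/astabP => v vs.
have gvs : inc_act v g \in s by rewrite (astabs_act _ gN).
case/inc_simplicesP: sD vs gvs => [[w ->]|[A [B [_ ->]]]]; rewrite !inE.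
  by move=> /eqP-> /eqP.
by case/orP => /eqP-> /orP[] /eqP.
Qed.

Definition incidence_graph : gcomplex {perm 'I_n} :=
  GComplex inc_simplex_neq0 inc_simplex_vertex inc_simplex_face
    inc_simplex_act inc_simplex_stab.

End IncidenceGraph.

(* Main.v *)
Require Import Defs.
From mathcomp Require Import all_boot all_order all_algebra all_fingroup.
From mathcomp Require Import all_solvable generic_quotient.
From mathcomp Require Import all_classical all_reals all_analysis.
From mathcomp Require Import fintype finset perm.
From mathcomp Require Import zify ring lra.

(** Write F for the set of fixed points of a p-subgroup P of S_n in [n]; then
    |F| is congruent to n mod p.

    If n = p + b and P is non-trivial, then either |F| = b, and F is a b-subset
    such that every other P-invariant b-subset meets F in exactly one point, so
    that the fixed graph is a star centred at F with some edges prolonged by one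
    more edge; or |F| = 1, b = p + 1, and the fixed graph is a star centred at
    the fixed point. In both cases it contracts N(P)-equivariantly.

    Conversely, restricting an N(P)-equivariant contraction to the points fixed
    by some H contained in N(P) shows that the vertices fixed by P and H lie in
    one component of the graph they span. It suffices to let P be generated by a
    p-cycle with support C. With H = N(P), some vertex is fixed by P and by
    Sym(F), so n = p + 1, b = p or b = n - p. If b = p, the vertex C is
    isolated in the fixed graph. If n = p + 1 and 1 < b < p, the stabilizer of a
    b-subset has order prime to p. If b = n - p > p + 1, choose S in F with
    |S| = b - p; then P, Sym(S) and Sym(F \ S) have no common fixed point in [n]
    but fix both F and the union of C and S, two b-subsets.

    S_n is transitive on the edges, so the orbit space is a segment. *)

Set Implicit Arguments.
Unset Strict Implicit.
Unset Printing Implicit Defensive.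

Import Order.TTheory GRing.Theory Num.Theory.
Import GroupScope.
Import numFieldNormedType.Exports.

(** * Geometric realizations: equivariant contractions and their fixed points *)

Section Realization.
Local Open Scope classical_set_scope.
Local Open Scope ring_scope.
Context (R : realType) (gT : finGroupType) (D : gcomplex gT).
Implicit Types (x : weights R D) (v : vertex D) (K : {set {set vertex D}}).

Lemma barycentric_continuous v : continuous (fun x => x v).
Proof. exact: (@proj_continuous _ (fun _ : vertex D => R) v). Qed.

Lemma weights_continuous (T : topologicalType) (f : T -> weights R D) :
  (forall v, continuous (fun t => f t v)) -> continuous f.
Proof.
move=> fc t; apply/cvg_sup => v.
exact: (continuous_comp_initial (fc v)).
Qed.

Lemma sum_continuous (I : Type) (T : topologicalType) (r : seq I) (P : pred I)
    (f : I -> T -> R) :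
  (forall i, continuous (f i)) -> continuous (fun t => \sum_(i <- r | P i) f i t).
Proof.
move=> fc t; apply: cvg_big => [|i _]; last exact: fc.
exact: add_continuous.
Qed.

Lemma continuous_affine (k l : R) : continuous (fun t : R => k - l * t).
Proof.
move=> t; apply: cvgB; first exact: cvg_cst.
by apply: cvgM; [exact: cvg_cst|exact: cvg_id].
Qed.

Lemma continuous_const (T : topologicalType) (k : R) : continuous (fun _ : T => k).
Proof. by move=> t; exact: cvg_cst. Qed.

Lemma continuous_add (T : topologicalType) (f g : T -> R) :
  continuous f -> continuous g -> continuous (fun t => f t + g t).
Proof. by move=> fc gc t; exact: (cvgD (fc t) (gc t)). Qed.

Lemma continuous_sub (T : topologicalType) (f g : T -> R) :
  continuous f -> continuous g -> continuous (fun t => f t - g t).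
Proof. by move=> fc gc t; exact: (cvgB (fc t) (gc t)). Qed.

Lemma continuous_mul (T : topologicalType) (f g : T -> R) :
  continuous f -> continuous g -> continuous (fun t => f t * g t).
Proof. by move=> fc gc t; exact: (cvgM (fc t) (gc t)). Qed.

Lemma continuous_maxl (T : topologicalType) (k : R) (f : T -> R) :
  continuous f -> continuous (fun t => Num.max k (f t)).
Proof.
by move=> fc t; exact: (@continuous_max R T (cst k) f t (cvg_cst _) (fc t)).
Qed.

Lemma continuous_minl (T : topologicalType) (k : R) (f : T -> R) :
  continuous f -> continuous (fun t => Num.min k (f t)).
Proof.
by move=> fc t; exact: (@continuous_min R T (cst k) f t (cvg_cst _) (fc t)).
Qed.

Definition vertex_point v : weights R D := fun u => (u == v)%:R.

Lemma realization_vertex_point K v :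
  finset.set1 v \in K -> realization (R := R) K (vertex_point v).
Proof.
move=> vK; split=> [u||].
- by rewrite /vertex_point ler0n.
- rewrite (bigD1 v)//= /vertex_point eqxx big1 ?addr0// => u /negPf ->//.
- rewrite (_ : finset _ = finset.set1 v)//; apply/setP => u.
  by rewrite !inE /vertex_point pnatr_eq0 eqb0 negbK.
Qed.

Lemma weights_act_vertex_point v g :
  weights_act (vertex_point v) g = vertex_point (vact D v g).
Proof.
apply/funext => u; rewrite /weights_act /vertex_point.
by rewrite -(inj_eq (act_inj (vact D) g)) actKV.
Qed.

(* Along a path in the realization the total weight of T is continuous with
   values in {0, 1}, hence constant. *)
Lemma equivariantly_contractible_separation (N : {set gT}) (H : {set gT}) K
    (T : {set vertex D}) :
  equivariantly_contractible R N (@weights_act R gT D) (realization (R := R) K) ->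
  H \subset N -> {subset K <= simplices D} ->
  (forall s, s \in K -> s \subset 'Fix_(vact D)(H)%g ->
     (s \subset T) || [disjoint s & T]) ->
  {in [pred v | finset.set1 v \in K & v \in 'Fix_(vact D)(H)%g] &,
    forall u v, (u \in T) = (v \in T)}.
Proof.
move=> [x0 [h [[Ax0 hc hA h0 h1] x0N hN]]] HN KD sep.
pose phi (x : weights R D) := \sum_(v in T) x v.
have phic : continuous phi by apply: sum_continuous => v; exact: barycentric_continuous.
have phi01 x : realization (R := R) K x -> (forall g, g \in H -> weights_act x g = x) ->
    phi x = 0 \/ phi x = 1.
  move=> [x_ge0 x_sum xK] xH.
  set s := [set v | x v != 0]%SET in xK.
  (* The support of an H-fixed point is H-stable, and [simplex_stab] then makes H fix each of its
     vertices. *)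
  have sH : s \subset 'Fix_(vact D)(H)%g.
    have sN : H \subset 'N(s | vact D)%g.
      apply/fintype.subsetP => g gH; rewrite !inE; apply/fintype.subsetP => v.
      by rewrite !inE -{2}(xH _ gH) /weights_act actK.
    apply/fintype.subsetP => v vs; apply/afixP => g gH.
    have := fintype.subsetP (simplex_stab (KD _ xK)) g (fintype.subsetP sN _ gH).
    by move/astab_act; apply.
  case/orP: (sep _ xK sH) => [sT|/pred0P sT].
    right; rewrite -x_sum; rewrite /phi [RHS](bigID (fun v => v \in T))/=.
    rewrite [X in _ + X]big1 ?addr0// => v vT; apply/eqP; apply: contraNT vT => vs.
    by apply: (fintype.subsetP sT); rewrite inE.
  left; rewrite /phi big1// => v vT; apply/eqP; move: (sT v) => /=.
  by rewrite vT andbT inE => /negbFE.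
have main v : finset.set1 v \in K -> v \in 'Fix_(vact D)(H)%g ->
    (v \in T)%:R = phi x0.
  move=> vK vH; have Av := realization_vertex_point vK.
  pose q t := phi (h (vertex_point v, t)).
  have q0 : q 0 = (v \in T)%:R.
    rewrite /q h0// /phi; case: (boolP (v \in T)) => vT.
      rewrite (bigD1 v)//= big1 /vertex_point ?eqxx ?addr0// => u /andP[_].
      by move/negPf->.
    rewrite big1// => u uT; rewrite /vertex_point; case: eqP => // uv.
    by rewrite -uv uT in vT.
  have q1 : q 1 = phi x0 by rewrite /q h1.
  (* The path starts at an H-fixed vertex, so by equivariance all of it consists of H-fixed points,
     to which [phi01] applies. *)
  have q01 t : 0 <= t <= 1 -> q t = 0 \/ q t = 1.
    move=> t01; apply: phi01; first exact: hA.
    move=> g gH; have gN := fintype.subsetP HN _ gH.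
    by rewrite -hN// weights_act_vertex_point (afixP vH).
  have qc : {within `[0, 1], continuous q}.
    apply/subspace_continuousP => t t01.
    have hct := (subspace_continuousP _ _).1 hc (vertex_point v, t) (conj Av t01).
    have pt : (vertex_point v, s) @[s --> within `[0, 1] (nbhs t)] -->
        within (realization (R := R) K `*` `[0, 1]) (nbhs (vertex_point v, t)).
      move=> B [[B1 B2] [/= nB1 nB2] sB].
      rewrite /nbhs /= /within /=; apply: filterS nB2 => s B2s s01.
      apply: (sB (vertex_point v, s)); last by split.
      by split => //; apply: nbhs_singleton.
    exact: cvg_comp (cvg_comp _ _ pt hct) (phic _).
  have half c : c \in `[0, 1]%R -> q c <> 2^-1.
    by rewrite in_itv => /q01[] ->; lra.
  rewrite -q0 -q1.
  case: (q01 0) => [|e0|e0]; first by rewrite lexx ler01.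
    case: (q01 1) => [|e1|e1]; first by rewrite ler01 lexx.
      by rewrite e0 e1.
    have [|c c01 /half] := @IVT R q 0 1 2^-1 ler01 qc; last by case.
    by rewrite e0 e1 min_l ?max_r ?ler01//; lra.
  case: (q01 1) => [|e1|e1]; first by rewrite ler01 lexx.
    have [|c c01 /half] := @IVT R q 0 1 2^-1 ler01 qc; last by case.
    by rewrite e0 e1 min_r ?max_l ?ler01//; lra.
  by rewrite e0 e1.
move=> u v /andP[uK uH] /andP[vK vH].
have : (u \in T)%:R = (v \in T)%:R :> R by rewrite !main.
by case: (u \in T) (v \in T) => -[] // /eqP; rewrite ?oner_eq0 // eq_sym oner_eq0.
Qed.

(** The end point [x0] of the contraction is N-fixed, so its support is an N-stable simplex; by
    [simplex_stab] every vertex of this simplex is N-fixed. *)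
Lemma equivariantly_contractible_fixed_vertex (N : {set gT}) K :
  equivariantly_contractible R N (@weights_act R gT D) (realization (R := R) K) ->
  {subset K <= simplices D} ->
  (forall s t : {set vertex D}, s \in K -> t \subset s ->
     t != finset.set0 -> t \in K) ->
  exists2 v, finset.set1 v \in K & v \in 'Fix_(vact D)(N)%g.
Proof.
move=> [x0 [h [[[x_ge0 x_sum xK] _ _ _ _] x0N _]]] KD Kface.
set s := [set v | x0 v != 0]%SET in xK.
have sN : N \subset 'N(s | vact D)%g.
  apply/fintype.subsetP => g gN; rewrite !inE; apply/fintype.subsetP => v.
  by rewrite !inE -{2}(x0N _ gN) /weights_act actK.
have : s != finset.set0.
  by apply: contraNneq (simplex_neq0 D) => <-; exact: KD.
case/finset.set0Pn => v vs; exists v.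
  apply: Kface xK _ _; first by rewrite finset.sub1set.
  by apply/finset.set0Pn; exists v; rewrite inE.
apply/afixP => g gN.
have := fintype.subsetP (simplex_stab (KD _ xK)) g (fintype.subsetP sN _ gN).
by move/astab_act; apply.
Qed.

(* First the graph is pushed along f during [0, 1/2], then along the cone with
   apex v0 during [1/2, 1]; at every time one of the two coefficients a, 1 - c
   vanishes. *)
Definition cone_homotopy (f : vertex D -> vertex D) (v0 : vertex D)
    (xt : weights R D * R) : weights R D := fun v =>
  let a := Num.max 0 (1 - 2 * xt.2) in
  let c := Num.min 1 (2 - 2 * xt.2) in
  c * (a * xt.1 v + (1 - a) * \sum_(u | f u == v) xt.1 u) +
  (1 - c) * (v == v0)%:R.

Lemma cone_homotopy_continuous f v0 : continuous (cone_homotopy f v0).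
Proof.
apply: weights_continuous => v; rewrite /cone_homotopy.
have cx u : continuous (fun xt : weights R D * R => xt.1 u).
  by move=> z; exact: (cvg_comp fst (fun x => x u) cvg_fst (@barycentric_continuous u z.1)).
have ca : continuous (fun xt : weights R D * R => Num.max 0 (1 - 2 * xt.2)).
  move=> z; have ra : continuous (fun t : R => Num.max 0 (1 - 2 * t)).
    by apply: continuous_maxl; exact: continuous_affine.
  exact: (cvg_comp snd (fun t => Num.max 0 (1 - 2 * t)) cvg_snd (ra z.2)).
have cc : continuous (fun xt : weights R D * R => Num.min 1 (2 - 2 * xt.2)).
  move=> z; have rc : continuous (fun t : R => Num.min 1 (2 - 2 * t)).
    by apply: continuous_minl; exact: continuous_affine.
  exact: (cvg_comp snd (fun t => Num.min 1 (2 - 2 * t)) cvg_snd (rc z.2)).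
have cs := sum_continuous (r := index_enum (vertex D)) (P := fun u => f u == v) cx.
have c1 (k : weights R D * R -> R) : continuous k -> continuous (fun z => 1 - k z).
  move=> kc; exact: (@continuous_sub _ _ k (@continuous_const _ 1) kc).
refine (@continuous_add _ _ _ _ _).
  refine (@continuous_mul _ _ _ cc _); refine (@continuous_add _ _ _ _ _).
    exact: (@continuous_mul _ _ _ ca (cx v)).
  exact: (@continuous_mul _ _ _ (c1 _ ca) cs).
exact: (@continuous_mul _ _ _ (c1 _ cc) (@continuous_const _ _)).
Qed.

(** While c = 1 the moving point is supported on the union of s and f(s), and while a = 0 on f(s)
    together with [v0]. The two hypotheses on s put these supports in K, up to passing to a face.
    Equivariance comes from f commuting with N and [v0] being N-fixed. *)
Lemma equivariantly_contractible_cone (N : {set gT}) K f v0 :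
  (forall s t : {set vertex D}, s \in K -> t \subset s ->
     t != finset.set0 -> t \in K) ->
  finset.set1 v0 \in K ->
  (forall s : {set vertex D}, s \in K -> (s :|: f @: s)%SET \in K) ->
  (forall s : {set vertex D}, s \in K -> (v0 |: f @: s)%SET \in K) ->
  (forall g, g \in N -> vact D v0 g = v0) ->
  (forall g v, g \in N -> f (vact D v g) = vact D (f v) g) ->
  equivariantly_contractible R N (@weights_act R gT D) (realization (R := R) K).
Proof.
move=> Kface v0K fK v0fK v0N fN.
exists (vertex_point v0), (cone_homotopy f v0); split; first split.
- exact: realization_vertex_point.
- by apply: continuous_subspaceT; exact: cone_homotopy_continuous.
- move=> x t [x_ge0 x_sum xK] t01; rewrite /cone_homotopy /=.
  set a := Num.max 0 _; set c := Num.min 1 _.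
  have a_ge0 : 0 <= a by rewrite le_max lexx.
  have a_le1 : a <= 1 by rewrite ge_max; apply/andP; split; lra.
  have c_le1 : c <= 1 by rewrite ge_min lexx.
  have c_ge0 : 0 <= c by rewrite le_min; apply/andP; split; lra.
  have ac : c = 1 \/ a = 0.
    rewrite /a /c; case: (leP t 2^-1) => t2; [left|right].
      by apply/min_idPl; lra.
    by apply/max_idPl; lra.
  set y := (fun v => _).
  have fx_ge0 v : 0 <= \sum_(u | f u == v) x u by apply: sumr_ge0.
  have y_ge0 v : 0 <= y v.
    rewrite /y; apply: addr_ge0; last by apply: mulr_ge0; [lra|exact: ler0n].
    by apply: mulr_ge0 => //; apply: addr_ge0; apply: mulr_ge0 => //; lra.
  have y_sum : \sum_v y v = 1.
    rewrite big_split /= -!mulr_sumr big_split /= -!mulr_sumr x_sum.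
    have -> : \sum_v \sum_(u | f u == v) x u = 1.
      by rewrite -x_sum [RHS](partition_big f xpredT).
    have -> : \sum_v (v == v0)%:R = 1 :> R.
      by rewrite (bigD1 v0)//= eqxx big1 ?addr0// => v /negPf ->.
    ring.
  split => //.
  have y_neq0 : [set v | y v != 0]%SET != finset.set0.
    apply/negP => /eqP/setP e; move: y_sum; rewrite big1.
      by move/eqP; rewrite eq_sym oner_eq0.
    by move=> v _; apply/eqP; move: (e v); rewrite !inE => /negbFE.
  have fx0 v : \sum_(u | f u == v) x u != 0 -> v \in (f @: [set v | x v != 0])%SET.
    apply: contraNT => vf; rewrite big1// => u /eqP uv; apply/eqP.
    by apply: contraNT vf => xu; apply/imsetP; exists u; rewrite ?inE.
  case: ac => [c1|a0].
    apply: Kface (fK _ xK) _ y_neq0; apply/fintype.subsetP => v; rewrite !inE.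
    apply: contraR; rewrite negb_or negbK => /andP[/eqP xv vf].
    rewrite /y c1 xv mulr0 subrr mul0r mul1r addr0 add0r.
    by apply/eqP; rewrite (eqP (contraNT (fx0 v) vf)) mulr0.
  apply: Kface (v0fK _ xK) _ y_neq0; apply/fintype.subsetP => v; rewrite !inE.
  apply: contraR; rewrite negb_or => /andP[/negPf vv0 vf].
  by rewrite /y a0 vv0 (eqP (contraNT (fx0 v) vf)) mul0r !mulr0 !addr0 mulr0.
- move=> x _; apply/funext => v; rewrite /cone_homotopy /= mulr0 !subr0.
  rewrite max_r ?ler01// min_l ?ler1n// subrr !mul0r addr0; ring.
- move=> x _; apply/funext => v; rewrite /cone_homotopy /vertex_point /= mulr1.
  by rewrite subrr min_r ?ler01// mul0r add0r subr0 mul1r.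
- by move=> g gN; rewrite weights_act_vertex_point v0N.
- move=> g x t gN _ _; apply/funext => v; rewrite /cone_homotopy /weights_act /=.
  congr (_ * (_ + _ * _) + _ * _).
    rewrite (reindex_inj (act_inj (vact D) g)) /=; apply: eq_big => u.
      by rewrite fN// -(inj_eq (act_inj (vact D) g^-1%g)) actK.
    by rewrite actK.
  by rewrite -[in RHS](inj_eq (act_inj (vact D) g)) actKV v0N.
Qed.

End Realization.

(** * Orbit spaces of graphs with a single orbit of edges *)

Section Slender.
Local Open Scope classical_set_scope.
Local Open Scope ring_scope.
Context (R : realType) (gT : finGroupType) (D : gcomplex gT).
Variables (a : pred (vertex D)) (u v : vertex D).

(** For a G-invariant colouring [a] separating the ends of the edge uv, this is the coordinate that
    identifies the orbit space with a segment. *)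
Definition mass (x : weights R D) : R := \sum_(w | a w) x w.

(** For fixed q, the straight path from the point q u + (1 - q) v of the edge, at t = 0, to its end
    u, at t = 1. *)
Definition edge_point (q t : R) : weights R D := fun w =>
  (w == u)%:R * ((1 - t) * q + t) + (w == v)%:R * ((1 - t) * (1 - q)).

Lemma edge_point_continuous (T : topologicalType) (q t : T -> R) :
  continuous q -> continuous t -> continuous (fun z => edge_point (q z) (t z)).
Proof.
move=> cq ct; apply: weights_continuous => w; rewrite /edge_point.
have c1 (k : T -> R) : continuous k -> continuous (fun z => 1 - k z).
  by move=> kc; exact: (@continuous_sub _ _ _ k (@continuous_const _ _ 1) kc).
have cst1 (w' : vertex D) := @continuous_const R T (w == w')%:R.
refine (@continuous_add _ _ _ _ _ _).
  refine (@continuous_mul _ _ _ _ (cst1 u) _).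
  exact: (@continuous_add _ _ _ _ (@continuous_mul _ _ _ _ (c1 _ ct) cq) ct).
refine (@continuous_mul _ _ _ _ (cst1 v) _).
exact: (@continuous_mul _ _ _ _ (c1 _ ct) (c1 _ cq)).
Qed.

Hypothesis au : a u.
Hypothesis av : ~~ a v.
Hypothesis uvD : [set u; v]%SET \in simplices D.
Hypothesis aJ : forall w g, a (vact D w g) = a w.
Hypothesis orbD : forall s, s \in simplices D ->
  exists g, [set vact D w g | w in s]%SET \subset [set u; v]%SET.

Let uv : u != v. Proof. by apply: contraTneq au => ->. Qed.

Lemma realization_edge_point x t : realization (simplices D) x -> 0 <= t <= 1 ->
  realization (simplices D) (edge_point (mass x) t).
Proof.
move=> [x_ge0 x_sum xD] t01; rewrite /edge_point /mass.
set q := \sum_(w | a w) x w.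
have q_ge0 : 0 <= q by apply: sumr_ge0.
have q_le1 : q <= 1.
  rewrite -x_sum [leRHS](bigID a)/= lerDl; exact: sumr_ge0.
have y_ge0 w : 0 <= (w == u)%:R * ((1 - t) * q + t) + (w == v)%:R * ((1 - t) * (1 - q)).
  rewrite addr_ge0// mulr_ge0 ?ler0n//; first by rewrite addr_ge0 ?mulr_ge0//; lra.
  by rewrite mulr_ge0//; lra.
have y_sum : \sum_w ((w == u)%:R * ((1 - t) * q + t) + (w == v)%:R * ((1 - t) * (1 - q))) = 1 :> R.
  have sum1 w' : \sum_(w : vertex D) (w == w')%:R = 1 :> R.
    by rewrite (bigD1 w')//= eqxx big1 ?addr0// => w /negPf ->.
  rewrite big_split /= -!mulr_suml !sum1; ring.
split => //.
apply: simplex_face uvD _ _.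
  apply/fintype.subsetP => w; rewrite !inE; apply: contraR.
  by rewrite negb_or => /andP[/negPf-> /negPf->]; rewrite !mul0r addr0.
apply/negP => /eqP/setP e; move/eqP: y_sum; rewrite big1 1?eq_sym ?oner_eq0//.
by move=> w _; apply/eqP; move: (e w); rewrite !inE => /negbFE.
Qed.

Lemma massJ x g : mass (weights_act x g) = mass x.
Proof.
rewrite /mass /weights_act (reindex_inj (act_inj (vact D) g)) /=.
by apply: eq_big => w; rewrite ?aJ// actK.
Qed.

(** Some g moves the support of x into the edge uv. There the barycentric coordinates are the mass,
    which g preserves, and its complement to 1. *)
Lemma edge_point0 x : realization (simplices D) x ->
  exists g, edge_point (mass x) 0 = weights_act x g.
Proof.
move=> [x_ge0 x_sum xD]; have [g gs] := orbD xD; exists g.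
have supp w : weights_act x g w != 0 -> (w == u) || (w == v).
  rewrite /weights_act => xw.
  have : w \in [set vact D w g | w in [set w | x w != 0]]%SET.
    by apply/imsetP; exists (vact D w g^-1%g); rewrite ?inE// actKV.
  by move/(fintype.subsetP gs); rewrite !inE.
rewrite -(massJ x g); set y := weights_act x g in supp *.
have y_sum : \sum_w y w = 1.
  rewrite -x_sum (reindex_inj (act_inj (vact D) g)) /=.
  by apply: eq_bigr => w _; rewrite /y /weights_act actK.
have y0 w : w != u -> w != v -> y w = 0.
  by move=> wu wv; apply/eqP; apply: contraT => /supp; rewrite (negPf wu) (negPf wv).
have yu : \sum_(w | a w) y w = y u.
  rewrite (bigD1 u)//= big1 ?addr0// => w /andP[aw wu]; apply: y0 => //.
  by apply: contraTneq aw => ->.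
have yv : 1 - y u = y v.
  rewrite -y_sum (bigD1 u)//= (bigD1 v) 1?eq_sym//= big1 ?addr0; first by ring.
  by move=> w /andP[wu wv]; exact: y0.
apply/funext => w; rewrite /edge_point /mass yu yv subr0 !mul1r addr0.
have [->|wu] := eqVneq w u; first by rewrite (negPf uv) mul1r mul0r addr0.
have [->|wv] := eqVneq w v; first by rewrite mul0r mul1r add0r.
by rewrite !mul0r addr0 y0.
Qed.

Lemma edge_point1 x : edge_point (mass x) 1 = vertex_point R u.
Proof.
apply/funext => w; rewrite /edge_point /mass /vertex_point subrr !mul0r add0r mulr0.
by rewrite mulr1 addr0.
Qed.

(** Homotopies take all real times, but [edge_point] is known to stay in the realization only for
    times in [0, 1]; clamping makes [lift] a total map into it. *)
Let clamp (t : R) : R := Num.max 0 (Num.min 1 t).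

Let clamp01 t : 0 <= clamp t <= 1.
Proof. by rewrite /clamp le_max lexx ge_max ler01 ge_min lexx. Qed.

Let lift (x : realization (simplices D)) (t : R) : realization (R := R) (simplices D) :=
  SigSub (mem_set (realization_edge_point (set_valP x) (clamp01 t))).

Let edge_homotopy (xt : orbit_space R D * R) : orbit_space R D :=
  \pi_(orbit_space R D)%qT (lift (repr xt.1) xt.2).

(** The choice of representatives [repr] need not be continuous, but [lift] depends on the
    representative only through its mass. Being constant on orbits, the mass descends to a
    continuous function on the quotient. *)
Lemma slender_edge : slender R D.
Proof.
pose p0 : realization (R := R) (simplices D) :=
  SigSub (mem_set (realization_vertex_point R (simplex_vertex u))).
have piE (x y : realization (R := R) (simplices D)) :
    (exists g, val y = weights_act (val x) g) ->
    \pi_(orbit_space R D)%qT x = \pi_(orbit_space R D)%qT y.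
  by move=> xy; apply/eqmodP/asboolP.
have clamp_continuous : continuous clamp.
  by apply: continuous_maxl; apply: continuous_minl; move=> t; exact: cvg_id.
have mass_continuous : continuous mass.
  by apply: sum_continuous => w; exact: barycentric_continuous.
have orbit_mass_continuous :
    continuous (fun q : orbit_space R D => mass (val (repr q))).
  have := @repr_comp_continuous _ {eq_quot (@in_same_orbit R gT D)}%qT R
    (fun x => mass (val x)); apply.
    have vc : continuous (val : realization (R := R) (simplices D) -> weights R D).
      exact: initial_continuous.
    by move=> x; exact: (cvg_comp val mass (vc x) (mass_continuous (val x))).
  by move=> x y /eqP/eqmodP/asboolP[g ->]; rewrite massJ.
have lift_continuous :
    continuous (fun xt : orbit_space R D * R => lift (repr xt.1) xt.2).
  apply: continuous_comp_initial.
  refine (@edge_point_continuous _ (fun xt : orbit_space R D * R => mass (val (repr xt.1)))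
    (fun xt => clamp xt.2) _ _) => z.
    exact: (cvg_comp fst (fun q : orbit_space R D => mass (val (repr q))) cvg_fst
      (orbit_mass_continuous z.1)).
  exact: (cvg_comp snd clamp cvg_snd (clamp_continuous z.2)).
exists (\pi_(orbit_space R D)%qT p0), edge_homotopy; split => //.
- apply: continuous_subspaceT => z.
  exact: (cvg_comp (fun xt : orbit_space R D * R => lift (repr xt.1) xt.2)
    \pi_(orbit_space R D)%qT (lift_continuous z) (@pi_continuous _
      {eq_quot (@in_same_orbit R gT D)}%qT (lift (repr z.1) z.2))).
- move=> q _; rewrite /edge_homotopy /= -[RHS]reprK; apply/esym/piE.
  have [g gE] := edge_point0 (set_valP (repr q)); exists g.
  by rewrite -gE /= /clamp min_r ?ler01// max_l.
- move=> q _; congr (\pi_(_)%qT _); apply: val_inj => /=.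
  by rewrite /clamp min_l// max_r ?ler01// edge_point1.
Qed.
End Slender.

(** * Permutations with prescribed images, symmetric groups of subsets, fixed points of p-groups *)

Section Permutations.
Local Open Scope nat_scope.
Context (T : finType).
Implicit Types (B C S : {set T}) (g : {perm T}) (P : {group {perm T}}).

Lemma seq_perm (s1 s2 : seq T) : uniq s1 -> uniq s2 -> size s1 = size s2 ->
  (forall x, x \in s1) -> exists g : {perm T}, map g s1 = s2.
Proof.
(* The default of [nth] is never reached: [s1] lists all of T and [s2] is as long as [s1]. *)
move=> u1 u2 s12 s1T; pose f x := nth x s2 (index x s1).
have f_inj : injective f.
  move=> x y; rewrite /f (set_nth_default y) -?s12 ?index_mem// => /eqP.
  rewrite nth_uniq -?s12 ?index_mem// => /eqP ixy.
  by rewrite -(nth_index x (s1T x)) ixy nth_index.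
exists (perm f_inj); case: s1 u1 s12 s1T @f f_inj => [|x0 s1]; first by case: s2 u2.
move=> u1 s12 s1T f f_inj.
apply: (@eq_from_nth _ x0); first by rewrite size_map.
move=> i; rewrite size_map => i_lt; rewrite (nth_map x0)// permE /f index_uniq//.
by apply: set_nth_default; rewrite -s12.
Qed.

Lemma flag_perm x x0 B B0 : x \in B -> x0 \in B0 -> #|B| = #|B0| ->
  exists g, g x = x0 /\ g @: B = B0.
Proof.
move=> xB xB0 BB0.
(* Matching the lists for (x, B) and (x0, B0) entry by entry sends x to x0 and, as the middle blocks
   have equal length, B to B0. *)
pose s y C := y :: enum (C :\ y) ++ enum (~: C).
have cardD y C : y \in C -> #|C :\ y| = #|C|.-1 by move=> yC; rewrite [in RHS](cardsD1 y) yC.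
have us y C : y \in C -> uniq (s y C).
  move=> yC; rewrite /= cat_uniq !enum_uniq mem_cat !mem_enum !inE eqxx yC /=.
  by rewrite andbT; apply/hasPn => z; rewrite !mem_enum !inE => /negPf ->; rewrite andbF.
have ss : size (s x B) = size (s x0 B0).
  have cC C : #|~: C| = #|T| - #|C| by rewrite cardsCs setCK.
  by rewrite /= !size_cat -!cardE !cardD// !cC BB0.
have [|g /= [gx /eqP]] := seq_perm (us _ _ xB) (us _ _ xB0) ss.
  move=> y; rewrite in_cons mem_cat !mem_enum !inE; case: eqP => //= _.
  by case: (y \in B).
rewrite map_cat eqseq_cat; last by rewrite size_map -!cardE !cardD// BB0.
move=> /andP[/eqP gB _]; exists g; split => //.
rewrite -(setD1K xB) -(setD1K xB0) imsetU1 gx; congr (_ |: _).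
apply/setP => y; rewrite -[in RHS]mem_enum -gB; apply/imsetP/mapP.
  by case=> z zB ->; exists z; rewrite ?mem_enum.
by case=> z; rewrite mem_enum => zB ->; exists z.
Qed.

Lemma Sym_stable S B :
  (Sym S \subset 'N(B | 'P)) = (S \subset B) || [disjoint S & B].
Proof.
apply/idP/orP => [SB|SB].
  case: (boolP [disjoint S & B]) => [|/pred0Pn[x /= /andP[xS xB]]]; first by right.
  left; apply/subsetP => y yS.
  (* If S meets B in x, swapping x with any other y in S must preserve B, so y lies in B. *)
  have : tperm x y \in 'N(B | 'P).
    apply: (subsetP SB); rewrite inE; apply/subsetP => z; rewrite inE.
    by case: tpermP => [->|->|_ _] //; rewrite eqxx.
  by move/astabs_act => /(_ x); rewrite /= apermE tpermL xB.
apply/subsetP => g; rewrite inE => gS; rewrite !inE; apply/subsetP => x xB.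
rewrite inE /= apermE; case: SB => [SB|/pred0P SB].
  have [xS|xS] := boolP (x \in S); last by rewrite (out_perm gS).
  by apply: (subsetP SB); rewrite perm_closed.
by rewrite (out_perm gS)//; move: (SB x); rewrite /= xB andbT => ->.
Qed.

Lemma Sym_sub_norm g S C : g \in Sym C -> [disjoint S & C] ->
  Sym S \subset 'N(<[g]>).
Proof.
move=> gC SC; apply: subset_trans (cent_sub _); rewrite cent_cycle.
apply/subsetP => h hS; apply/cent1P; rewrite !inE in gC hS.
exact: (perm_onC hS gC SC).
Qed.

(** Cauchy's theorem gives g of order p in Sym(C). The number of its fixed points in C is a multiple
    of p, hence 0 or p, and p would force g = 1. *)
Lemma Sym_cycle_prime p C : prime p -> #|C| = p ->
  exists g, [/\ g \in Sym C, #[g] = p & 'Fix_('P)(<[g]>) = ~: C].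
Proof.
move=> pr_p Cp.
have /(Cauchy pr_p)[g gC og] : p %| #|Sym C| by rewrite card_Sym Cp dvdn_fact// prime_gt0 /=.
exists g; split => //.
have pg : p.-group <[g]> by rewrite /pgroup -orderE og pnat_id.
have gP : <[g]> \subset 'N(C | 'P).
  by rewrite cycle_subG; apply: subsetP gC; rewrite Sym_stable subxx.
have FC : ~: C \subset 'Fix_('P)(<[g]>).
  apply/subsetP => x; rewrite inE => xC; rewrite afix_cycle; apply/afix1P.
  by rewrite /= apermE (out_perm _ xC)//; rewrite inE in gC.
have := pgroup_fix_mod pg gP; rewrite Cp modnn.
move/esym/eqP; rewrite -/(dvdn _ _) => pF.
have FC_le : #|'Fix_(C | 'P)(<[g]>)| <= p by rewrite -Cp subset_leq_card ?subsetIl.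
have F0 : 'Fix_(C | 'P)(<[g]>) = set0.
  apply/eqP; rewrite -cards_eq0; apply: contraT => F0.
  have FpC : 'Fix_(C | 'P)(<[g]>) = C.
    by apply/eqP; rewrite eqEcard subsetIl Cp dvdn_leq// lt0n.
  have g1 : g = 1%g.
    apply/permP => x; rewrite perm1.
    have : x \in 'Fix_('P)(<[g]>).
      have [xC|xC] := boolP (x \in C); last by apply: (subsetP FC); rewrite inE.
      by move: xC; rewrite -{1}FpC => /setIP[].
    by rewrite afix_cycle => /afix1P.
  by move: og; rewrite g1 order1 => p1; move: pr_p; rewrite -p1.
apply/eqP; rewrite eqEsubset FC andbT; apply/subsetP => x xF; rewrite inE.
by apply/negP => xC; have := in_set0 x; rewrite -F0 inE xC xF.
Qed.

Lemma subset_of_card k B C : B \subset C -> #|B| <= k <= #|C| ->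
  exists S, [/\ B \subset S, S \subset C & #|S| = k].
Proof.
move=> BC /andP[Bk kC]; pose r := take (k - #|B|) (enum (C :\: B)).
have rC x : x \in r -> x \in C :\: B by move/mem_take; rewrite mem_enum.
have ur : uniq r by rewrite take_uniq ?enum_uniq.
exists (B :|: [set x in r]); split.
- exact: subsetUl.
- rewrite subUset BC; apply/subsetP => x; rewrite inE => /rC.
  by rewrite inE => /andP[].
- rewrite cardsU (_ : B :&: _ = set0) ?cards0 ?subn0.
    rewrite cardsE (card_uniqP ur) size_takel ?subnKC// -cardE cardsDS//.
    exact: leq_sub2r.
  apply/setP => x; rewrite !inE; apply/negP => /andP[xB /rC].
  by rewrite inE xB.
Qed.

Lemma pgroup_card_mod (p : nat) P B : p.-group P -> P \subset 'N(B | 'P) ->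
  #|B| = #|B :&: 'Fix_('P)(P)| %[mod p].
Proof. exact: pgroup_fix_mod. Qed.

(** B and its set of fixed points have congruent cardinals mod p, both less than p, so they
    coincide. *)
Lemma pgroup_fix_small (p : nat) P B : p.-group P -> P \subset 'N(B | 'P) -> #|B| < p ->
  B \subset 'Fix_('P)(P).
Proof.
move=> pP PB Bp; apply/setIidPl/eqP; rewrite eqEcard subsetIl /=.
have := pgroup_card_mod pP PB; rewrite !modn_small// => [->//|].
by rewrite (leq_ltn_trans _ Bp)// subset_leq_card ?subsetIl.
Qed.

End Permutations.

(** * The incidence graph of points and b-subsets, and its fixed graphs *)

Section Graph.
Local Open Scope nat_scope.
Context (n b : nat).
Hypothesis bn : 0 < b < n.
Notation G := {perm 'I_n}.
Notation D := (incidence_graph n 1 b).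
Implicit Types (H : {set {perm 'I_n}}) (P : {group {perm 'I_n}}).
Implicit Types (A : ksubset n 1) (B : ksubset n b).

Lemma fix_ksubset k (A : ksubset n k) H :
  (H \subset 'N(val A | 'P)) = [forall g in H, ksubset_act A g == A].
Proof.
rewrite -astab1_set; apply/subsetP/forall_inP => [HA g gH|HA g gH].
  by apply/eqP/val_inj; have /astab1P := HA _ gH.
by apply/astab1P; have /eqP/(congr1 val) := HA _ gH.
Qed.

Definition ksubset_action k : {action {perm 'I_n} &-> ksubset n k} :=
  TotalAction (@ksubset_act1 n k) (@ksubset_actM n k).

Lemma fix_inl A H : (inl A \in 'Fix_(vact D)(H)) = (H \subset 'N(val A | 'P)).
Proof.
rewrite fix_ksubset; apply/afixP/forall_inP => HA g gH.
  by have [->] := HA g gH.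
by congr inl; apply/eqP/HA.
Qed.

Lemma fix_inr B H : (inr B \in 'Fix_(vact D)(H)) = (H \subset 'N(val B | 'P)).
Proof.
rewrite fix_ksubset; apply/afixP/forall_inP => HA g gH.
  by have [->] := HA g gH.
by congr inr; apply/eqP/HA.
Qed.

Lemma ksubset1P A : exists x, val A = [set x].
Proof. by apply/cards1P; exact: (valP A). Qed.

Lemma fix_point A H : (H \subset 'N(val A | 'P)) = (val A \subset 'Fix_('P)(H)).
Proof.
have [x ->] := ksubset1P A; rewrite finset.sub1set astabs_set1.
apply/subsetP/afixP => HA g gH; last by apply/astab1P; exact: HA.
by have /astab1P := HA _ gH.
Qed.

Definition pt (x : 'I_n) : ksubset n 1 := Sub [set x] (introT eqP (cards1 x)).

(** The bounds on b leave no isolated vertex: a point extends to a b-subset, and a b-subset contains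
    a point. Arguments on simplices may thus consider edges only. *)
Lemma simplex_sub_edge (s : {set vertex D}) : s \in simplices D ->
  exists A B, val A \subset val B /\ s \subset [set inl A; inr B].
Proof.
case/andP: bn => b_gt0 b_lt.
case/inc_simplicesP => [[[A|B] ->]|[A [B [AB ->]]]]; last by exists A, B.
- have [|B [AB _ /eqP cB]] := @subset_of_card _ b _ _ (subsetT (val A)).
    by rewrite (eqP (valP A)) b_gt0 cardsT card_ord ltnW.
  by exists A, (Sub B cB : ksubset n b); rewrite finset.sub1set !inE eqxx.
- have : 0 < #|val B| by rewrite (eqP (valP B)).
  case/card_gt0P => x xB; exists (pt x), B.
  by rewrite !finset.sub1set !inE eqxx orbT.
Qed.

(** By [flag_perm] all edges lie in one orbit, and being a point rather than a b-subset is an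
    invariant colouring that separates the ends of an edge. *)
Lemma incidence_graph_slender (R : realType) : slender R D.
Proof.
case/andP: bn => b_gt0 b_lt.
have n_gt0 : 0 < n by exact: leq_ltn_trans b_lt.
have [_ [B0 _]] := simplex_sub_edge (simplex_vertex (inl (pt (Ordinal n_gt0)) : vertex D)).
have : 0 < #|val B0| by rewrite (eqP (valP B0)).
case/card_gt0P => x0 x0B.
pose pts (v : vertex D) := if v is inl _ then true else false.
apply: (@slender_edge R _ D pts (inl (pt x0)) (inr B0)) => //.
- by apply/inc_simplicesP; right; exists (pt x0), B0; rewrite finset.sub1set.
- by case.
- move=> s /simplex_sub_edge[A [B [AB sAB]]]; have [x Ax] := ksubset1P A.
  have xB : x \in val B by rewrite -finset.sub1set -Ax.
  have BB0 : #|val B| = #|val B0| by rewrite (eqP (valP B)) (eqP (valP B0)).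
  have [g [gx gB]] := flag_perm xB x0B BB0.
  exists g; apply: subset_trans (imsetS _ sAB) _.
  rewrite imsetU1 imset_set1 (_ : vact D (inl A) g = inl (pt x0)).
    rewrite (_ : vact D (inr B) g = inr B0)//.
    by congr inr; exact: val_inj.
  by congr inl; apply: val_inj; rewrite /= Ax imset_set1 gx.
Qed.

Lemma fixed_simplices_sub H : {subset fixed_simplices D H <= simplices D}.
Proof. by move=> s; rewrite inE => /andP[]. Qed.

Lemma fixed_simplices_face H (s t : {set vertex D}) :
  s \in fixed_simplices D H -> t \subset s -> t != set0 -> t \in fixed_simplices D H.
Proof.
rewrite ![_ \in fixed_simplices _ _]inE => /andP[sD sH] ts t0.
rewrite (subset_trans ts sH) andbT.
exact: simplex_face sD ts t0.
Qed.

Lemma fixed_simplices_set1 H (v : vertex D) :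
  ([set v] \in fixed_simplices D H) = (v \in 'Fix_(vact D)(H)).
Proof. by rewrite inE simplex_vertex finset.sub1set. Qed.

Lemma fixed_simplices_edge H A B : val A \subset val B ->
  H \subset 'N(val A | 'P) -> H \subset 'N(val B | 'P) ->
  [set inl A; inr B] \in fixed_simplices D H.
Proof.
move=> AB HA HB; rewrite inE subUset !finset.sub1set fix_inl fix_inr HA HB !andbT.
by apply/inc_simplicesP; right; exists A, B.
Qed.

Lemma fixed_simplicesP H (s : {set vertex D}) : s \in fixed_simplices D H ->
  [\/ exists2 A, H \subset 'N(val A | 'P) & s = [set inl A],
     exists2 B, H \subset 'N(val B | 'P) & s = [set inr B] |
     exists A B, [/\ val A \subset val B, H \subset 'N(val A | 'P),
       H \subset 'N(val B | 'P) & s = [set inl A; inr B]]].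
Proof.
rewrite inE => /andP[/inc_simplicesP[[[A|B] ->]|[A [B [AB ->]]]]].
- by rewrite finset.sub1set fix_inl; constructor 1; exists A.
- by rewrite finset.sub1set fix_inr; constructor 2; exists B.
- rewrite subUset !finset.sub1set fix_inl fix_inr => /andP[HA HB].
  by constructor 3; exists A, B.
Qed.

Lemma norm_fix P g : g \in 'N(P) -> g @: 'Fix_('P)(P) = 'Fix_('P)(P).
Proof.
move=> gP; have /subsetP/(_ g) := acts_subnorm_fix 'P P.
by rewrite !setTI => /(_ gP); exact: astabs_setact.
Qed.


(** * Sufficiency: contracting the fixed graphs *)

Section FixedGraph.
Context (R : realType) (P : {group {perm 'I_n}}).
Let F := 'Fix_('P)(P).
Let K := fixed_simplices D P.

(** The only fixed point lies in every P-invariant b-subset, so the fixed graph is already a cone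
    and the first half of the homotopy may be constant. *)
Lemma fixed_graph_contractible_point (A0 : ksubset n 1) : val A0 = F ->
  (forall B, P \subset 'N(val B | 'P) -> F \subset val B) ->
  equivariantly_contractible R 'N(P) (@weights_act R _ D) (realization (R := R) K).
Proof.
move=> A0F FB.
have A0P : P \subset 'N(val A0 | 'P) by rewrite fix_point A0F.
have PA0 A : P \subset 'N(val A | 'P) -> A = A0.
  rewrite fix_point -/F -A0F => AA0; apply/val_inj/eqP; rewrite eqEcard AA0.
  by rewrite (eqP (valP A)) (eqP (valP A0)).
apply: (@equivariantly_contractible_cone R _ D _ K id (inl A0)) => //.
- exact: fixed_simplices_face.
- by rewrite fixed_simplices_set1 fix_inl.
- by move=> s sK; rewrite imset_id setUid.
- move=> s sK; rewrite imset_id.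
  case/fixed_simplicesP: sK => [[A PA ->]|[B PB ->]|[A [B [AB PA PB ->]]]].
  + by rewrite (PA0 _ PA) setUid fixed_simplices_set1 fix_inl.
  + by apply: fixed_simplices_edge => //; rewrite A0F FB.
  + by rewrite (PA0 _ PA) setUA setUid; apply: fixed_simplices_edge; rewrite ?A0F ?FB// -A0F.
- by move=> g gP; congr inl; apply: val_inj; rewrite /= A0F norm_fix.
Qed.

Lemma fixed_graph_contractible_subset (B0 : ksubset n b) : val B0 = F ->
  (forall B, P \subset 'N(val B | 'P) -> B = B0 \/ #|val B :&: F| = 1) ->
  equivariantly_contractible R 'N(P) (@weights_act R _ D) (realization (R := R) K).
Proof.
move=> B0F PB0.
have B0P : P \subset 'N(val B0 | 'P) by rewrite B0F (subset_trans _ (astab_sub _ _))// astabC.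
(* The prolonged edges are folded back: a b-subset other than F goes to its only neighbour in the
   fixed graph, the point where it meets F. The last value [inr B] does not occur for P-invariant B
   and keeps f equivariant on all vertices. *)
pose f (v : vertex D) : vertex D := match v with
  | inl A => inl A
  | inr B => if B == B0 then inr B else
     if insub (val B :&: F) is Some A then inl A else inr B
  end.
have fB B : P \subset 'N(val B | 'P) ->
    f (inr B) = inr B /\ B = B0 \/
    exists A, [/\ f (inr B) = inl A, val A = val B :&: F, val A \subset val B &
      P \subset 'N(val A | 'P)].
  move=> PB; rewrite /f; case: eqP => [->|BB0]; first by left.
  case: (PB0 _ PB) => // /eqP BF; right.
  case: insubP => [A _ AE|]; last by rewrite BF.
  by exists A; rewrite fix_point AE subsetIl subsetIr; split.
have AK A : P \subset 'N(val A | 'P) -> [set inl A] \in K.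
  by move=> PA; rewrite fixed_simplices_set1 fix_inl.
have B0K : [set inr B0] \in K by rewrite fixed_simplices_set1 fix_inr.
have uniqA A A' B : val A' = val B :&: F -> P \subset 'N(val A | 'P) ->
    val A \subset val B -> A' = A.
  move=> A'BF; rewrite fix_point => AF AB; apply/esym/val_inj/eqP.
  by rewrite eqEcard A'BF subsetI AB AF -A'BF (eqP (valP A)) (eqP (valP A')).
have AB0 A : P \subset 'N(val A | 'P) -> [set inl A; inr B0] \in K.
  by move=> PA; apply: fixed_simplices_edge => //; move: PA; rewrite fix_point B0F.
apply: (@equivariantly_contractible_cone R _ D _ K f (inr B0)) => //.
- exact: fixed_simplices_face.
- move=> s; case/fixed_simplicesP => [[A PA ->]|[B PB ->]|[A [B [AB PA PB ->]]]].
  + by rewrite imset_set1 setUid AK.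
  + rewrite imset_set1; case: (fB _ PB) => [[-> ->]|[A [-> _ AB PA]]].
      by rewrite setUid.
    by rewrite setUC; exact: fixed_simplices_edge.
  + rewrite imsetU1 imset_set1; case: (fB _ PB) => [[-> ->]|[A' [-> A'BF _ _]]].
      by rewrite setUid AB0.
    rewrite (uniqA A A' B)// setUid setUAC setUid; exact: fixed_simplices_edge.
- move=> s; case/fixed_simplicesP => [[A PA ->]|[B PB ->]|[A [B [AB PA PB ->]]]].
  + by rewrite imset_set1 setUC AB0.
  + rewrite imset_set1; case: (fB _ PB) => [[-> ->]|[A [-> _ AB PA]]].
      by rewrite setUid.
    by rewrite setUC AB0.
  + rewrite imsetU1 imset_set1; case: (fB _ PB) => [[-> ->]|[A' [-> A'BF _ _]]].
      by rewrite setUCA setUid AB0.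
    by rewrite (uniqA A A' B)// setUid setUC AB0.
- by move=> g gP; congr inr; apply: val_inj; rewrite /= B0F norm_fix.
- move=> g [A|B] gP //=. 
  (* Elements of N(P) preserve F, hence both the test for B = F and the intersection of B with F. *)
  have gB0 : ksubset_act B0 g = B0 by apply: val_inj; rewrite /= B0F norm_fix.
  have -> : (ksubset_act B g == B0) = (B == B0).
    by rewrite -{1}gB0 (inj_eq (act_inj (ksubset_action b) g)).
  case: (B == B0) => //; have gF : g @: F = F := norm_fix gP.
  rewrite -{1}gF -imsetI; last by move=> ? ? _ _; exact: perm_inj.
  case: insubP => [A' _ A'E|]; case: insubP => [A _ AE|].
  - by congr inl; apply: val_inj; rewrite /= A'E AE.
  - by rewrite -(card_imset _ (@perm_inj _ g)) -A'E (valP A').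
  - by rewrite (card_imset _ (@perm_inj _ g)) -AE (valP A).
  - by [].
Qed.

End FixedGraph.

(** In an edge containing s, the complement of the b-subset has n - b = p elements; its symmetric
    group, of order p!, fixes both ends. *)
Lemma stab_simplex_dvd (p : nat) (s : {set vertex D}) : n = p + b -> 0 < p -> s \in simplices D ->
  p %| #|'N(s | vact D)|.
Proof.
move=> np p_gt0 /simplex_sub_edge[A [B [AB sAB]]].
have cB : #|~: val B| = p by rewrite cardsCs setCK card_ord (eqP (valP B)) np addnK.
apply: (@dvdn_trans #|Sym (~: val B)|).
  by rewrite card_Sym cB dvdn_fact// p_gt0 /=.
apply: cardSg; apply: subset_trans (astab_sub _ _); rewrite astabC.
apply: (subset_trans sAB); rewrite subUset !finset.sub1set fix_inl fix_inr !Sym_stable.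
by rewrite !disjoints_subset setCS AB subxx !orbT.
Qed.

Lemma synthetic_sufficient (R : realType) (p : nat) : prime p -> n = p + b ->
  b = p.+1 \/ b < p -> synthetic_building R D p.
Proof.
move=> pr_p np bp; split=> [P pP P1|s]; last by apply: stab_simplex_dvd; rewrite ?prime_gt0.
have PT : P \subset 'N([set: 'I_n] | 'P).
  by apply/subsetP => g _; rewrite !inE; apply/subsetP => x _; rewrite !inE.
set F := 'Fix_('P)(P).
have Fn : #|F| = b %[mod p].
  have := pgroup_card_mod pP PT; rewrite setTI cardsT card_ord => <-.
  by rewrite [in LHS]np modnDl.
have F_lt : #|F| < n.
  rewrite ltnNge; apply: contraNN P1 => nF; apply/eqP/trivgP/subsetP => g gP.
  have FT : F = setT by apply/eqP; rewrite eqEcard subsetT cardsT card_ord.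
  rewrite inE; apply/eqP/permP => x; rewrite perm1.
  by have /afixP/(_ _ gP) : x \in F by rewrite FT inE.
have p_gt1 := prime_gt1 pr_p.
(* This applies both to |F| and to the number of fixed points in an invariant b-subset. *)
have modb k : k = b %[mod p] -> k < p + b -> k = b \/ (k = 1 /\ b = p.+1).
  move=> kb k_lt; have kE := divn_eq k p; rewrite kb in kE.
  case: bp => [bE|b_lt].
    have b1 : b %% p = 1 by rewrite bE -addn1 modnDl modn_small.
    by rewrite b1 in kE; case: (k %/ p) kE => [|[|q]]; nia.
  by rewrite (modn_small b_lt) in kE; case: (k %/ p) kE => [|q]; nia.
have Fmod B : P \subset 'N(val B | 'P) ->
    #|val B :&: F| = b \/ (#|val B :&: F| = 1 /\ b = p.+1).
  move=> PB; apply: modb; first by rewrite -(pgroup_card_mod pP PB) (eqP (valP B)).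
  rewrite (@leq_ltn_trans b)//; last by rewrite -[X in X < _]add0n ltn_add2r; lia.
  by rewrite -[leqRHS](eqP (valP B)) subset_leq_card ?subsetIl.
have [//||Fb|[F1 bE]] := modb #|F|; first by rewrite -np.
- pose B0 : ksubset n b := Sub F (introT eqP Fb).
  apply: (@fixed_graph_contractible_subset R P B0) => // B PB.
  case: (Fmod _ PB) => [BF|[]]; last by right.
  left; apply/val_inj/eqP; rewrite eqEcard /= -/F Fb (eqP (valP B)) leqnn andbT.
  by apply/setIidPl/eqP; rewrite eqEcard subsetIl BF (eqP (valP B)) leqnn.
- pose A0 : ksubset n 1 := Sub F (introT eqP F1).
  apply: (@fixed_graph_contractible_point R P A0) => // B PB.
  have B1 : 0 < #|val B :&: F| by case: (Fmod _ PB) => [|[]] ->; lia.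
  by apply/setIidPr/eqP; rewrite eqEcard subsetIr -/F F1.
Qed.

(** * Necessity of the conditions on n, b and p *)

Section Necessity.
Context (R : realType) (P : {group {perm 'I_n}}).
Hypothesis contP : equivariantly_contractible R 'N(P) (@weights_act R _ D)
  (realization (R := R) (fixed_simplices D P)).

(** No edge fixed by P and H ends at [B0], so the set consisting of [B0] alone separates the fixed
    vertices; by contractibility there is no other one. *)
Lemma isolated_fixed_vertex (H : {set {perm 'I_n}}) (B0 : ksubset n b) (v : vertex D) :
  H \subset 'N(P) -> P \subset 'N(val B0 | 'P) -> H \subset 'N(val B0 | 'P) ->
  (forall A, P \subset 'N(val A | 'P) -> H \subset 'N(val A | 'P) ->
     ~~ (val A \subset val B0)) ->
  v \in 'Fix_(vact D)(P) -> v \in 'Fix_(vact D)(H) -> v = inr B0.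
Proof.
move=> HN PB0 HB0 AB0 vP vH; apply/set1P.
rewrite (@equivariantly_contractible_separation R _ D _ H _ [set inr B0] contP HN _ _ v (inr B0)).
- by rewrite inE.
- exact: fixed_simplices_sub.
- move=> s; case/fixed_simplicesP => [[A PA ->]|[B PB ->]|[A [B [AB PA PB ->]]]].
  + by move=> _; rewrite disjoints1 inE orbT.
  + move=> _; rewrite disjoints1 finset.sub1set; exact: orbN.
  + rewrite subUset !finset.sub1set fix_inl => /andP[HA _]; apply/orP; right.
    rewrite disjoint_sym disjoints1 !inE negb_or /=.
    by apply: contraNneq (AB0 _ PA HA) => -[->].
- by rewrite inE fixed_simplices_set1 vP.
- by rewrite inE fixed_simplices_set1 fix_inr PB0 fix_inr.
Qed.

Lemma norm_fixed_vertex : exists2 v, v \in 'Fix_(vact D)(P) & v \in 'Fix_(vact D)('N(P)).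
Proof.
have [||v vP vN] := equivariantly_contractible_fixed_vertex contP.
- exact: fixed_simplices_sub.
- exact: fixed_simplices_face.
- by exists v => //; rewrite -fixed_simplices_set1.
Qed.

End Necessity.

(** An element of order p stabilizing B would act on B and on its complement, both too small for a
    non-trivial orbit, and so would be the identity. *)
Lemma stab_subset_ndvd (p : nat) (B : ksubset n b) : prime p -> b < p -> n - b < p ->
  ~~ (p %| #|'N([set (inr B : vertex D)] | vact D)|).
Proof.
move=> pr_p b_lt nb_lt; apply/negP => /(Cauchy pr_p)[h hN oh].
have ph : p.-group <[h]> by rewrite /pgroup -orderE oh pnat_id.
have hB : <[h]> \subset 'N(val B | 'P).
  rewrite -fix_inr afix_cycle; apply/afix1P.
  by apply/astab1P; rewrite -astabs_set1.
have BF : val B \subset 'Fix_('P)(<[h]>).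
  by apply: (pgroup_fix_small ph hB); rewrite (eqP (valP B)).
have CF : ~: val B \subset 'Fix_('P)(<[h]>).
  apply: (pgroup_fix_small ph); first by rewrite astabsC.
  by rewrite cardsCs setCK card_ord (eqP (valP B)).
have h1 : h = 1%g.
  apply/permP => x; rewrite perm1.
  have : x \in 'Fix_('P)(<[h]>).
    have [xB|xB] := boolP (x \in val B); first exact: (subsetP BF).
    by apply: (subsetP CF); rewrite inE.
  by rewrite afix_cycle => /afix1P.
by move: oh pr_p; rewrite h1 order1 => <-.
Qed.

Lemma synthetic_necessary (R : realType) (p : nat) : prime p -> p <= n ->
  synthetic_building R D p -> n = p + b /\ (b = p.+1 \/ b < p).
Proof.
move=> pr_p pn [cont stab]; have p_gt1 := prime_gt1 pr_p.
case/andP: bn => b_gt0 b_lt.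
have [|C [_ _ Cp]] := @subset_of_card _ p _ _ (sub0set [set: 'I_n]).
  by rewrite cards0 cardsT card_ord.
have [g [gC og FE]] := Sym_cycle_prime pr_p Cp.
have pg : p.-group <[g]> by rewrite /pgroup -orderE og pnat_id.
have P1 : <[g]>%G :!=: 1%g by rewrite -cardG_gt1 -orderE og.
have contP := cont <[g]>%G pg P1.
have Fp : #|~: C| = n - p by rewrite cardsCs setCK card_ord Cp.
have C_stable B : ((C \subset val B) || [disjoint C & val B]) ->
    <[g]> \subset 'N(val B | 'P).
  by rewrite -Sym_stable cycle_subG => /subsetP; apply.
have Sym_norm (S : {set 'I_n}) : S \subset ~: C -> Sym S \subset 'N(<[g]>).
  by rewrite -disjoints_subset; exact: Sym_sub_norm.
have point_fixed A : (<[g]> \subset 'N(val A | 'P)) = (val A \subset ~: C).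
  by rewrite fix_point FE.
(* N(P) contains Sym(F), with F the complement of C. A fixed point in F forces |F| = 1. A fixed
   b-subset contains F or misses it, and meets C in 0 or p elements; since 0 < b < n, it has n - p
   or p elements. *)
have bE : [\/ n = p.+1, b = p | b = n - p].
  have [[A|B]] := norm_fixed_vertex contP; rewrite ?fix_inl ?fix_inr.
    rewrite point_fixed => AF /(subset_trans (Sym_norm _ (subxx _))).
    rewrite Sym_stable => /orP[/subset_leq_card|].
      have := subset_leq_card AF; rewrite Fp (eqP (valP A)) => F1 F1'.
      by constructor 1; lia.
    have [x Ax] := ksubset1P A; rewrite Ax finset.sub1set in AF *.
    by rewrite disjoint_sym disjoints1 AF.
  move=> gB /(subset_trans (Sym_norm _ (subxx _))); rewrite Sym_stable => FB.
  have pB := pgroup_card_mod pg gB; rewrite FE -(cardsID (~: C) (val B)) in pB.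
  have BE := cardsID (~: C) (val B); rewrite (eqP (valP B)) in BE.
  have BC : #|val B :\: ~: C| <= p by rewrite setDE setCK -Cp subset_leq_card ?subsetIr.
  have pBC : p %| #|val B :\: ~: C|.
    by move/eqP: pB; rewrite -[X in _ == X %[mod _]]addn0 eqn_modDl mod0n.
  case/orP: FB => [/setIidPr BF|].
    rewrite BF Fp in BE; constructor 3.
    case: (posnP #|val B :\: ~: C|) => [B0|/dvdn_leq/(_ pBC)]; lia.
  rewrite disjoint_sym -setI_eq0 => /eqP BF; rewrite BF cards0 add0n in BE.
  by constructor 2; apply/eqP; rewrite eqn_leq -{1}BE BC -BE dvdn_leq// BE.
have bp : b <> p.
  move=> bp; have /card_gt0P[x] : 0 < #|~: C| by rewrite Fp; lia.
  rewrite inE => xC.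
  pose B0 : ksubset n b := Sub C (introT eqP (etrans Cp (esym bp))).
  suff : inl (pt x) = inr B0 :> vertex D by [].
  (* An empty H imposes nothing: C contains no point fixed by P, so it is isolated already in the
     fixed graph of P. *)
  apply: (@isolated_fixed_vertex R _ contP set0); rewrite ?fix_inl ?sub0set//.
  - by apply: C_stable; rewrite subxx.
  - move=> A + _; rewrite point_fixed; have [y ->] := ksubset1P A.
    by rewrite !finset.sub1set inE.
  - by rewrite point_fixed finset.sub1set inE.
(* If n = p + 1, then b = 1 is the claim, and for b > 1 both b and n - b are less than p. *)
have {}bE : b = n - p.
  case: bE => [n_p1|//|//]; case: (ltnP 1 b) => [b_gt1|]; last by lia.
  have [|B [_ _ /eqP cB]] := @subset_of_card _ b _ _ (sub0set [set: 'I_n]).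
    by rewrite cards0 cardsT card_ord /= ltnW.
  have b_ltp : b < p by lia.
  have nb_ltp : n - b < p by lia.
  case/negP: (stab_subset_ndvd (Sub B cB) pr_p b_ltp nb_ltp).
  by apply: stab; exact: simplex_vertex.
split; first by lia.
case: (ltnP b p) => [|pb]; [by right|left].
apply/eqP; rewrite eqn_leq; apply/andP; split; last by lia.
rewrite leqNgt; apply/negP => b_gt.
(* S has b - p elements and the rest of F has p. Both numbers are at least 2, so the two symmetric
   groups together fix no point of F. *)
have [|S [_ SF cS]] := @subset_of_card _ (b - p) _ _ (sub0set (~: C)).
  by rewrite cards0 Fp; lia.
have cCS : #|C :|: S| == b.
  rewrite cardsU (_ : C :&: S = set0) ?cards0 ?Cp ?cS; first by apply/eqP; lia.
  by apply/eqP; rewrite setI_eq0 disjoint_sym disjoints_subset.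
pose B0 : ksubset n b := Sub (~: C) (introT eqP (etrans Fp (esym bE))).
pose B1 : ksubset n b := Sub (C :|: S) cCS.
have B10 : inr B1 = inr B0 :> vertex D.
  apply: (@isolated_fixed_vertex R _ contP (Sym S :|: Sym (~: C :\: S))).
  - by rewrite subUset !Sym_norm// subsetDl.
  - by apply: C_stable; rewrite disjoints_subset setCK subxx orbT.
  - by rewrite subUset !Sym_stable /= SF subsetDl.
  - move=> A; rewrite point_fixed subUset !Sym_stable; have [x ->] := ksubset1P A.
    rewrite finset.sub1set inE => xC /andP[/orP[/subset_leq_card|]].
      by rewrite cS cards1; lia.
    rewrite disjoint_sym disjoints1 => xS /orP[/subset_leq_card|].
      by rewrite cards1 cardsDS// Fp cS; lia.
    by rewrite disjoint_sym disjoints1 !inE xS xC.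
  - by rewrite fix_inr; apply: C_stable; rewrite subsetUl.
  - rewrite fix_inr subUset !Sym_stable /= subsetUr /=; apply/orP; right.
    by rewrite disjoints_subset setCU setDE subxx.
have /card_gt0P[x xC] : 0 < #|C| by rewrite Cp; lia.
have [BE] := B10; have : x \in C :|: S by rewrite inE xC.
by rewrite BE inE xC.
Qed.

End Graph.

Theorem corollary6p6 (R : realType) (p n b : nat) :
  prime p -> (p <= n)%N -> (1 <= b < n)%N ->
  (synthetic_building R (incidence_graph n 1 b) p <->
     n = (p + b)%N /\ (b = (p + 1)%N \/ (1 <= b <= p - 1)%N)) /\
  (synthetic_building R (incidence_graph n 1 b) p ->
     slender R (incidence_graph n 1 b)).
Proof.
move=> pr_p pn bn; have p_gt1 := prime_gt1 pr_p; split; last first.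
  by move=> _; exact: incidence_graph_slender.
split=> [/(synthetic_necessary bn pr_p pn)[np bp]|[np bp]]; first by split=> //; lia.
by apply: synthetic_sufficient => //; lia.
Qed.
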